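(* Let $A\in\mathbb{C}^{p\times p}$, $B\in\mathbb{C}^{q\times q}$, $C\in\mathbb{C}^{p\times q}$, and let $m\ge k=\mathrm{Ind}(A)$ and $n\ge l=\mathrm{Ind}(B)$ be integers. Let $(A^{m})^{(1)}$ and $(B^{n})^{(1)}$ be $\{1\}$-inverses of $A^m$ and $B^n$ respectively. If $X_0\in\mathbb{C}^{p\times q}$ is a particular solution of the matrix equation $A^{m}XB^{n}=C$ (in the unknown $X\in\mathbb{C}^{p\times q}$), then the general solution of this equation is given by the formula $$X=g(Y)=X_{0}+Y-(A^{m})^{(1)}A^{m}YB^{n}(B^{n})^{(1)},$$ where $Y\in\mathbb{C}^{p\times q}$ is arbitrary; that is, for every $Y\in\mathbb{C}^{p\times q}$ the matrix $g(Y)$ is a solution, and every solution $X$ is of the form $X=g(Y)$ for some $Y\in\mathbb{C}^{p\times q}$.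
   Context: For a complex matrix $M\in\mathbb{C}^{a\times b}$, a $\{1\}$-inverse of $M$ is any matrix $M^{(1)}\in\mathbb{C}^{b\times a}$ with $MM^{(1)}M=M$; it always exists but in general is not unique. For a square matrix $M$, the index $\mathrm{Ind}(M)$ is the smallest non-negative integer $k$ with $\mathrm{rank}(M^k)=\mathrm{rank}(M^{k+1})$ (with $M^0=I$). A formula $X=\phi(Y)$ represents the general solution of an equation if $\phi(Y)$ is a solution for every $Y$, and every solution $X$ equals $\phi(Y)$ for some $Y$. *)

(* Defs.v *)
From mathcomp Require Import all_boot all_order all_algebra.
From mathcomp Require Import complex.
From mathcomp Require Import reals.

Set Implicit Arguments.
Unset Strict Implicit.
Unset Printing Implicit Defensive.

Import GRing.Theory.
Local Open Scope ring_scope.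

Definition one_inverse (F : fieldType) (a b : nat)
    (M : 'M[F]_(a, b)) (G : 'M[F]_(b, a)) : Prop :=
  M *m G *m M = M.

Lemma mxindex_exists (F : fieldType) (n : nat) (M : 'M[F]_n) :
  exists k, \rank (M ^+ k) == \rank (M ^+ k.+1).
Proof.
have dec k : (\rank (M ^+ k.+1) <= \rank (M ^+ k))%N.
  by rewrite exprS; apply: mxrankM_maxr.
suff H d : forall k, (\rank (M ^+ k) <= d)%N ->
    exists k, \rank (M ^+ k) == \rank (M ^+ k.+1).
  by apply: (H _ 0%N (leqnn _)).
elim: d => [|d IH] k hk.
  by exists k; rewrite eqn_leq dec (leq_trans hk).
have [|ne] := eqVneq (\rank (M ^+ k)) (\rank (M ^+ k.+1)).
  by exists k; apply/eqP.
apply: (IH k.+1); rewrite -ltnS; apply: leq_trans hk.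
by rewrite ltn_neqAle eq_sym ne dec.
Qed.

Definition mxindex (F : fieldType) (n : nat) (M : 'M[F]_n) : nat :=
  ex_minn (mxindex_exists M).

(* Main.v *)
Require Import Defs.
From mathcomp Require Import all_boot all_order all_algebra.
From mathcomp Require Import complex.
From mathcomp Require Import reals.

Set Implicit Arguments.
Unset Strict Implicit.
Unset Printing Implicit Defensive.

Import GRing.Theory.
Local Open Scope ring_scope.

(** Since A^m (A^m)^(1) A^m = A^m and B^n (B^n)^(1) B^n = B^n, the correction term
    of g(Y) has the same image A^m Y B^n as Y, so g(Y) solves the equation.
    Conversely a solution X equals g(X - X0): the correction term vanishes because
    X - X0 solves the homogeneous equation. *)
Theorem theorem2p2 (R : realType) (p q : nat)
    (A : 'M[R[i]]_p) (B : 'M[R[i]]_q) (C : 'M[R[i]]_(p, q))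
    (m n : nat) (hm : (mxindex A <= m)%N) (hn : (mxindex B <= n)%N)
    (Am1 : 'M[R[i]]_p) (Bn1 : 'M[R[i]]_q)
    (hAm1 : one_inverse (A ^+ m) Am1) (hBn1 : one_inverse (B ^+ n) Bn1)
    (X0 : 'M[R[i]]_(p, q)) (hX0 : A ^+ m *m X0 *m B ^+ n = C) :
  let g (Y : 'M[R[i]]_(p, q)) :=
    X0 + Y - Am1 *m A ^+ m *m Y *m B ^+ n *m Bn1 in
  (forall Y : 'M[R[i]]_(p, q), A ^+ m *m g Y *m B ^+ n = C) /\
  (forall X : 'M[R[i]]_(p, q), A ^+ m *m X *m B ^+ n = C ->
     exists Y : 'M[R[i]]_(p, q), X = g Y).
Proof.
move=> g; rewrite /g; split=> [Y|X hX].
  rewrite mulmxBr mulmxBl mulmxDr mulmxDl hX0.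
  (* Regrouping puts a product of the form M G M on each side of [Y]; the {1}-inverse identities
     collapse these to [A ^+ m] and [B ^+ n], so this term cancels the contribution of [Y]. *)
  have -> : A ^+ m *m (Am1 *m A ^+ m *m Y *m B ^+ n *m Bn1) *m B ^+ n
            = (A ^+ m *m Am1 *m A ^+ m) *m Y *m (B ^+ n *m Bn1 *m B ^+ n).
    by rewrite !mulmxA.
  by rewrite hAm1 hBn1 addrK.
exists (X - X0).
have hXX0 : A ^+ m *m (X - X0) *m B ^+ n = 0.
  by rewrite mulmxBr mulmxBl hX hX0 subrr.
(* Regrouping isolates the homogeneous expression [A ^+ m *m (X - X0) *m B ^+ n], which is zero,
   between [Am1] and [Bn1]. *)
have -> : Am1 *m A ^+ m *m (X - X0) *m B ^+ n *m Bn1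
          = Am1 *m (A ^+ m *m (X - X0) *m B ^+ n) *m Bn1.
  by rewrite !mulmxA.
by rewrite hXX0 mulmx0 mul0mx subr0 addrC subrK.
Qed.
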